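(* Let $k$ be an algebraically closed field of characteristic $p$. For every $p$-nonspecial tuple $(d_1,\dots,d_c)$ such that $\max(d_1,\dots,d_c)\geq p$, and for every $n$ such that the Fano index $n+1-(d_1+\dots+d_c)$ is $\geq 2$, there exists a smooth complete intersection in $\mathbb{P}^n_k$ of type $(d_1,\dots,d_c)$ that has no free lines.
   Context: Here $p$ is a prime. For an integer $d>1$, the $p$-adic valuation of $d$ is the unique integer $v\ge 0$ such that $d=p^ve$ with $e$ an integer prime to $p$. The integer $d$ is $p$-special if $1\le e<p$ and $p$-nonspecial if $e>p$. An ordered tuple of positive integers $(d_1,\dots,d_c)$ is $p$-special if for every $d_i\ge p$: when $d_i$ is divisible by $p$, the integer $d_i$ is $p$-special; and when $d_i$ is prime to $p$, the integer $d_i+1$ is $p$-special. Otherwise the tuple is $p$-nonspecial. A complete intersection of type $(d_1,\dots,d_c)$ in $\mathbb{P}^n_k$ is the common zero scheme, of dimension $n-c$, of homogeneous polynomials of degrees $d_1,\dots,d_c$. A line in $X\subset\mathbb{P}^n_k$ is (the embedding of) a degree-$1$ rational curve $u:\mathbb{P}^1_k\to X$; it is free if $u^*T_X$ is globally generated. *)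

(* Defs.v *)
From HB Require Import structures.
From mathcomp Require Import all_boot all_order all_algebra.
From mathcomp Require Import mpoly.

Set Implicit Arguments.
Unset Strict Implicit.
Unset Printing Implicit Defensive.

Import Order.TTheory GRing.Theory Num.Theory.

Local Open Scope ring_scope.

(* d`_p^' is the prime-to-p part of d: d = p ^ v * d`_p^' with v = logn p d.
   Meant for p prime and d > 1; then d is p-nonspecial iff it is not
   p-special, because the prime-to-p part is never equal to p. *)
Definition p_special (p d : nat) : Prop := (1 <= d`_p^' < p)%N.

Definition p_special_tuple (p c : nat) (d : c.-tuple nat) : Prop :=
  forall i : 'I_c, (p <= tnth d i)%N ->
    ((p %| tnth d i)%N -> p_special p (tnth d i)) /\
    (coprime p (tnth d i) -> p_special p (tnth d i).+1).

Definition p_nonspecial_tuple (p c : nat) (d : c.-tuple nat) : Prop :=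
  ~ p_special_tuple p d.

Definition fano_index (n c : nat) (d : c.-tuple nat) : int :=
  (n.+1)%:Z - (\sum_(i < c) tnth d i)%:Z.

(* Closed points of P^n are represented by nonzero x : 'rV[k]_n.+1, their
   homogeneous coordinates.  All the schemes whose points, morphisms or sections
   are tested below (a smooth X, and P^1) are reduced and of finite type over an
   algebraically closed field, so closed points suffice. *)

Definition mevalv (k : fieldType) (m : nat) (f : {mpoly k[m]}) (x : 'rV[k]_m)
    : k :=
  f.@[fun j => x 0 j].

Definition on_zero_locus (k : fieldType) (n c : nat)
    (F : 'I_c -> {mpoly k[n.+1]}) (x : 'rV[k]_n.+1) : Prop :=
  forall i : 'I_c, mevalv (F i) x = 0.

Definition jacobian (k : fieldType) (n c : nat)
    (F : 'I_c -> {mpoly k[n.+1]}) (x : 'rV[k]_n.+1) : 'M[k]_(c, n.+1) :=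
  \matrix_(i < c, j < n.+1) mevalv ((F i)^`M(j)) x.

(* The c equations have linearly independent differentials at every point of the
   zero scheme X, that is, X is smooth over k of relative dimension n - c.  When
   c <= n the scheme X is nonempty, and this says exactly that X has dimension
   n - c and is smooth. *)
Definition smooth_complete_intersection (k : fieldType) (n c : nat)
    (d : c.-tuple nat) (F : 'I_c -> {mpoly k[n.+1]}) : Prop :=
  (forall i : 'I_c, F i != 0 /\ F i \is (tnth d i).-homog) /\
  (forall x : 'rV[k]_n.+1, x != 0 -> on_zero_locus F x ->
     \rank (jacobian F x) = c).

(* A morphism P^1 -> P^n of degree 1 is given by n + 1 linear forms in two
   variables without common zero on P^1; these are the columns of a matrix L,
   the morphism is [y] |-> [y *m L], and the absence of common zeros means that
   L is row-free. *)
Definition line_in (k : fieldType) (n c : nat)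
    (F : 'I_c -> {mpoly k[n.+1]}) (L : 'M[k]_(2, n.+1)) : Prop :=
  row_free L /\
  (forall y : 'rV[k]_2, y != 0 -> on_zero_locus F (y *m L)).

(* The tangent space of P^n at [x] is Hom(<x>, k^(n+1) / <x>).  A tangent vector
   phi is represented by any w : 'rV_n.+1 lifting phi x; so w is taken modulo x,
   and rescaling x by a rescales w by a. *)
Definition eq_tangent (k : fieldType) (n : nat) (x w w' : 'rV[k]_n.+1) : Prop :=
  (w - w' <= x)%MS.

Definition tangent_to (k : fieldType) (n c : nat)
    (F : 'I_c -> {mpoly k[n.+1]}) (x w : 'rV[k]_n.+1) : Prop :=
  jacobian F x *m w^T = 0.

(* Global sections of u^* T_X, where u [y] = [y *m L]: s y represents a vector
   of T_{X, u [y]} with respect to the coordinates y *m L of u [y].  The second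
   condition says that this vector depends only on the point [y] of P^1; the
   third one that it is a regular function of [y], i.e., is locally given by
   quotients of homogeneous polynomials of the right degree. *)
Definition tangent_section (k : fieldType) (n c : nat)
    (F : 'I_c -> {mpoly k[n.+1]}) (L : 'M[k]_(2, n.+1))
    (s : 'rV[k]_2 -> 'rV[k]_n.+1) : Prop :=
  [/\ forall y : 'rV[k]_2, y != 0 -> tangent_to F (y *m L) (s y),
      forall (a : k) (y : 'rV[k]_2), a != 0 -> y != 0 ->
        eq_tangent (y *m L) (s (a *: y)) (a *: s y)
    & forall y0 : 'rV[k]_2, y0 != 0 ->
        exists (m : nat) (h : {mpoly k[2]}) (g : 'I_n.+1 -> {mpoly k[2]}),
          [/\ h \is m.-homog,
              forall j : 'I_n.+1, g j \is m.+1.-homog,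
              mevalv h y0 != 0
            & forall y : 'rV[k]_2, mevalv h y != 0 -> y != 0 ->
                eq_tangent (y *m L) (s y)
                  ((mevalv h y)^-1 *: \row_(j < n.+1) mevalv (g j) y)]].

(* u^* T_X is globally generated: at every point of P^1, the global sections
   span, hence (being a vector space) fill, the fiber. *)
Definition free_line (k : fieldType) (n c : nat)
    (F : 'I_c -> {mpoly k[n.+1]}) (L : 'M[k]_(2, n.+1)) : Prop :=
  forall (y : 'rV[k]_2) (w : 'rV[k]_n.+1),
    y != 0 -> tangent_to F (y *m L) w ->
    exists2 s : 'rV[k]_2 -> 'rV[k]_n.+1,
      tangent_section F L s & eq_tangent (y *m L) (s y) w.

(* Main.v *)
Require Import Defs.
From HB Require Import structures.
From mathcomp Require Import all_boot all_order all_algebra.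
From mathcomp Require Import mpoly.

Set Implicit Arguments.
Unset Strict Implicit.
Unset Printing Implicit Defensive.

Import Order.TTheory GRing.Theory Num.Theory.

Local Open Scope ring_scope.

(** Why the theorem holds.

Write [S_e] for the binary forms of degree [e] in letters [s, t].  A line in
[X] is free exactly when the partial derivatives of the equations, restricted
to the line, span the direct sum of the [S_(d_i - 1)].  If [p] divides the
binomial coefficient of [d - 1] over [q + 1], then the binary forms of degree
[d - 1] without the monomial [s^(q+1) t^(r+1)], where [q + r + 3 = d], contain
all powers of linear forms and their polarizations.  So it suffices that the
partial derivatives of one equation, of degree [d], only involve powers
[x_j^(d-1)] and products [(d-1) x_j^(d-2) x_l]; this is so for the forms
[sum A_jl x_j^(d-1) x_l], called [powlin d A] below.  Such a monomial exists as
soon as [d >= p] has a prime-to-[p] part exceeding [p], which is what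
nonspecialness provides for some [d_i] ([nonspecial_binomial]).

Smooth members ([exists_smooth_powlin]).  On each chart [x_s = 1] the forms
[powlin d A] contain all affine functions, so the value and the differential of
each equation at a given point can be prescribed freely.  A singular system
together with a witness (a singular point and a linear relation between the
differentials) is therefore determined by one parameter less than there are
coefficients.  The image of a polynomial map from fewer parameters lies in a
hypersurface ([algebraic_dependence]), and finitely many hypersurfaces do not
cover an affine space over an algebraically closed field
([avoid_polynomial_images]).

Absence of free lines ([free_line_absurd]).  This is Serre duality made
explicit.  On the line, the missing monomial gives
[grad F = s^(q+2) A + t^(r+2) B] with vectors [A], [B] of forms of degrees [r],
[q].  On tangent vectors of [X] the left-hand side vanishes, so
[A / t^(r+2) = - B / s^(q+2)] is a linear form on [u^* T_X] with values in
O(-1), and it kills all global sections ([dot_section]).  If the line is free,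
then [A] kills [u^* T_X] everywhere, hence [A] is a combination of the
gradients of all equations.  The coefficient of [grad F] in it is a section of
O(-q-2), so it is [0], yet it is [1] at the point [t = 0], where
[grad F = s^(q+2) A].  Both vanishing statements are
[regular_negative_eq0]. *)

(** * Polynomial maps from too few parameters *)

Lemma meval_muni (R : comNzRingType) (n : nat) (P : {mpoly R[n.+1]})
    (v : 'I_n.+1 -> R) :
  P.@[v] = (map_poly (meval (fun i => v (widen_ord (leqnSn n) i)))
              (muni P)).[v ord_max].
Proof.
rewrite muniE raddf_sum horner_sum mevalE; apply: eq_bigr => m _.
rewrite /= map_polyZ hornerZ map_polyXn hornerXn /= mevalZ mevalX -mulrA.
rewrite big_ord_recr /=; congr (_ * (_ * _)).
by apply: eq_bigr => i _; rewrite mnmE.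
Qed.

Lemma muni_eq0 (R : nzRingType) (n : nat) (P : {mpoly R[n.+1]}) :
  muni P = 0 -> P = 0.
Proof.
move=> P0; apply/mpolyP => m; rewrite mcoeff0.
have: (muni P)`_(m ord_max)@_[multinom m (widen_ord (leqnSn n) i) | i < n] = 0.
  by rewrite P0 coef0 mcoeff0.
rewrite muniE coef_sum raddf_sum /=.
have [mP | /memN_msupp_eq0 //] := boolP (m \in msupp P).
rewrite (bigD1_seq m) //= big1_seq => [|m' /andP[ne_m' _]].
  by rewrite coefZ coefXn eqxx mulr1 mcoeffZ mcoeffX eqxx mulr1 addr0.
rewrite coefZ coefXn; have [eq_max|_] := eqVneq; last by rewrite mulr0 mcoeff0.
rewrite mulr1 mcoeffZ mcoeffX; have [/mnmP eq_m|_] := eqVneq; last exact: mulr0.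
case/eqP: ne_m'; apply/mnmP => i; case: (unliftP ord_max i) => [j|] -> //.
have := eq_m j; rewrite !mnmE.
have -> // : widen_ord (leqnSn n) j = lift ord_max j.
by apply: val_inj; rewrite [RHS]lift_max.
Qed.

(** A univariate polynomial over an infinite field has a non-root; the letters
are specialized one at a time. *)
Lemma mpoly_nonroot (k : closedFieldType) (n : nat) (P : {mpoly k[n]}) :
  P != 0 -> exists v : 'I_n -> k, P.@[v] != 0.
Proof.
elim: n P => [|n IHn] P nzP.
  exists (fun _ => 0); apply: contra_neq nzP => P0.
  apply/mpolyP => m; rewrite mcoeff0.
  have m0 : m = 0%MM by apply/mnmP; case.
  have [mP | /memN_msupp_eq0 //] := boolP (m \in msupp P).
  move: P0; rewrite mevalE (bigD1_seq m) //= big_ord0 mulr1 big1_seq ?addr0 //.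
  move=> m' /andP[/eqP[]]; rewrite m0; apply/mnmP; case => //.
have nz_muni : lead_coef (muni P) != 0.
  by rewrite lead_coef_eq0; apply: contra_neq nzP => /muni_eq0.
have [v nz_v] := IHn _ nz_muni.
have /closed_nonrootP[x] : map_poly (meval v) (muni P) != 0.
  by rewrite -lead_coef_eq0 lead_coef_map_eq.
rewrite /root => nz_x.
exists (fun i => if insub (val i) is Some j then v j else x).
rewrite meval_muni; move: nz_x; rewrite /= insubF ?ltnn //.
rewrite -(@eq_map_poly _ _ (meval v)) // => p.
apply: meval_eq => i /=; rewrite insubT // => lt_in.
by congr (v _); apply: val_inj.
Qed.

Lemma msize_prod_leq (R : idomainType) (n : nat) (T : finType) (b : nat)
    (P : T -> {mpoly R[n]}) (e : T -> nat) (N : nat) :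
  (forall t, msize (P t) <= b.+1)%N -> (forall t, e t <= N)%N ->
  (msize (\prod_t P t ^+ e t) <= (#|T| * (N * b)).+1)%N.
Proof.
move=> Pb eN.
have mulb (p q : {mpoly R[n]}) x y :
    (msize p <= x.+1)%N -> (msize q <= y.+1)%N ->
    (msize (p * q) <= (x + y).+1)%N.
  have [->|nzp] := eqVneq p 0; first by rewrite mul0r msize0.
  have [->|nzq] := eqVneq q 0; first by rewrite mulr0 msize0.
  move=> px qy; rewrite msizeM // -subn1 leq_subLR.
  by apply: leq_trans (leq_add px qy) _; rewrite addnS addSn add1n.
have powb t j : (msize (P t ^+ j) <= (j * b).+1)%N.
  elim: j => [|j IHj]; first by rewrite expr0 msize1.
  by rewrite exprS mulSn mulb.
have -> : (#|T| * (N * b))%N = (\sum_(t : T) N * b)%N.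
  by rewrite sum_nat_const.
elim/big_rec2: _ => [|t x p _ IH]; first by rewrite msize1.
rewrite mulb //; apply: leq_trans (powb _ _) _.
by rewrite ltnS leq_mul2r eN orbT.
Qed.

(** Monomial counting: the polynomials in [E] letters with exponents below [N]
form a space of dimension [N ^ E], while substituting the [P i] lands in a
space of dimension [O(N ^ D)], so for large [N] the substitution has a kernel. *)
Lemma algebraic_dependence (k : fieldType) (D E : nat)
    (P : 'I_E -> {mpoly k[D]}) : (D < E)%N ->
  exists2 R : {mpoly k[E]}, R != 0 &
    forall v : 'I_D -> k, R.@[fun i => (P i).@[v]] = 0.
Proof.
move=> ltDE; pose b := (\max_i msize (P i))%N.
have Pb i : (msize (P i) <= b.+1)%N by apply/leqW/(leq_bigmax i).
(* [N] makes [M ^ D <= ((E * b).+1 * N) ^ D < N ^ D.+1 <= N ^ E]. *)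
pose N := ((E * b).+1 ^ D).+1; pose M := (E * (N * b)).+1.
pose mon n q (f : {ffun 'I_n -> 'I_q}) := [multinom (f i : nat) | i < n].
have mon_inj n q : injective (@mon n q).
  move=> f g /mnmP eq_fg; apply/ffunP => i; apply: val_inj.
  by have:= eq_fg i; rewrite !mnmE.
pose Q (f : {ffun 'I_E -> 'I_N}) : {mpoly k[D]} := \prod_i P i ^+ f i.
have szQ f : (msize (Q f) <= M)%N.
  rewrite /Q; have := @msize_prod_leq _ _ _ b P (fun i => f i) N Pb.
  by rewrite card_ord; apply=> i; apply: ltnW.
pose A := \matrix_(i < #|{ffun 'I_E -> 'I_N}|, j < #|{ffun 'I_D -> 'I_M}|)
  (Q (enum_val i))@_(mon _ _ (enum_val j)).
have lt_card : (#|{ffun 'I_D -> 'I_M}| < #|{ffun 'I_E -> 'I_N}|)%N.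
  rewrite !card_ffun !card_ord.
  have leM : (M <= (E * b).+1 * N)%N.
    by rewrite /M mulnCA mulSn mulnC -addn1 addnC leq_add2r.
  apply: leq_ltn_trans (_ : ((E * b).+1 * N) ^ D < _)%N.
    by have [D0|D_gt0] := posnP D; [rewrite D0 !expn0 | rewrite leq_exp2r].
  rewrite expnMn; apply: leq_trans (_ : N ^ D.+1 <= _)%N.
    by rewrite expnS ltn_pmul2r // expn_gt0.
  by rewrite leq_pexp2l.
have nz_ker : kermx A != 0.
  rewrite -mxrank_eq0 mxrank_ker -lt0n subn_gt0.
  exact: leq_ltn_trans (rank_leq_col _) lt_card.
have /rowV0Pn[u /sub_kermxP uA nz_u] := nz_ker.
pose R := \sum_i u 0 i *: 'X_[mon _ _ (enum_val i)] : {mpoly k[E]}.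
exists R.
  apply: contra_neq nz_u => R0; apply/rowP => i; rewrite mxE.
  have: R@_(mon _ _ (enum_val i)) = 0 by rewrite R0 mcoeff0.
  rewrite raddf_sum (bigD1 i) //= big1 => [|j ne_ji].
    by rewrite mcoeffZ mcoeffX eqxx mulr1 addr0.
  rewrite mcoeffZ mcoeffX; case: eqVneq => [/mon_inj/enum_val_inj eq_ji|].
    by rewrite eq_ji eqxx in ne_ji.
  by rewrite mulr0.
have QR : \sum_i u 0 i *: Q (enum_val i) = 0.
  apply/mpolyP => m; rewrite mcoeff0 raddf_sum /=.
  have [ltm | lem] := ltnP (mdeg m) M; last first.
    rewrite big1 // => i _; rewrite mcoeffZ memN_msupp_eq0 ?mulr0 //.
    exact/msize_mdeg_ge/(leq_trans (szQ _)).
  have ltmi i : (m i < M)%N.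
    by apply: leq_ltn_trans ltm; rewrite mdegE (bigD1 i) //= leq_addr.
  pose g : {ffun 'I_D -> 'I_M} := [ffun i => Ordinal (ltmi i)].
  have mg : m = mon _ _ g by apply/mnmP => i; rewrite mnmE ffunE.
  have := congr1 (fun B : 'rV_ _ => B 0 (enum_rank g)) uA; rewrite !mxE => {2}<-.
  by apply: eq_bigr => i _; rewrite mcoeffZ mxE enum_rankK mg.
move=> v; transitivity ((\sum_i u 0 i *: Q (enum_val i)).@[v]); last first.
  by rewrite QR meval0.
rewrite !raddf_sum /=; apply: eq_bigr => i _.
rewrite !mevalZ mevalX /Q rmorph_prod; congr (_ * _).
by apply: eq_bigr => j _; rewrite rmorphXn /= mnmE.
Qed.

Section PolynomialFunctions.
Variables (k : comNzRingType) (J : finType).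
Implicit Types f g : (J -> k) -> k.

Definition polyfun f : Prop :=
  exists P : {mpoly k[#|J|]}, forall v, f v = P.@[fun i => v (enum_val i)].

Lemma polyfun_cst (a : k) : polyfun (fun=> a).
Proof. by exists a%:MP => v; rewrite mevalC. Qed.

Lemma polyfun_var (j : J) : polyfun (fun v => v j).
Proof. by exists 'X_(enum_rank j) => v; rewrite mevalXU enum_rankK. Qed.

Lemma polyfunD f g : polyfun f -> polyfun g -> polyfun (fun v => f v + g v).
Proof. by move=> [P fP] [Q gQ]; exists (P + Q) => v; rewrite mevalD fP gQ. Qed.

Lemma polyfunM f g : polyfun f -> polyfun g -> polyfun (fun v => f v * g v).
Proof. by move=> [P fP] [Q gQ]; exists (P * Q) => v; rewrite mevalM fP gQ. Qed.

Lemma polyfunN f : polyfun f -> polyfun (fun v => - f v).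
Proof. by move=> [P fP]; exists (- P) => v; rewrite mevalN fP. Qed.

Lemma polyfunX f e : polyfun f -> polyfun (fun v => f v ^+ e).
Proof. by move=> [P fP]; exists (P ^+ e) => v; rewrite rmorphXn /= fP. Qed.

Lemma polyfun_sum (T : finType) (Q : pred T) (f : T -> (J -> k) -> k) :
  (forall t, polyfun (f t)) -> polyfun (fun v => \sum_(t | Q t) f t v).
Proof.
case/fin_all_exists=> P fP; exists (\sum_(t | Q t) P t) => v.
by rewrite raddf_sum; apply: eq_bigr => t _; apply: fP.
Qed.

End PolynomialFunctions.

(** Images of polynomial maps from fewer parameters lie in hypersurfaces, and
finitely many hypersurfaces do not cover an affine space over an infinite
field. *)
Lemma avoid_polynomial_images (k : closedFieldType) (I T S : finType)
    (J : T -> finType) (f : forall t, (J t -> k) -> I -> k)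
    (Q : S -> (I -> k) -> k) :
  (forall t, #|J t| < #|I|)%N ->
  (forall t i, polyfun (fun v => f t v i)) ->
  (forall s, polyfun (Q s)) -> (forall s, exists a, Q s a != 0) ->
  exists a : I -> k,
    (forall t v, ~ f t v =1 a) /\ (forall s, Q s a != 0).
Proof.
move=> ltJI polf polQ nzQ.
have eqR t : exists2 R : {mpoly k[#|I|]}, R != 0 &
    forall v, R.@[fun i => f t v (enum_val i)] = 0.
  have [P fP] := fin_all_exists (polf t).
  have [R nzR R0] := algebraic_dependence (fun i => P (enum_val i)) (ltJI t).
  exists R => // v; rewrite -[RHS](R0 (fun j => v (enum_val j))).
  by apply: meval_eq => i; rewrite fP.
have [R nzR R0] := fin_all_exists2 eqR.
have [U QU] := fin_all_exists polQ.
have nzU s : U s != 0.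
  have [a] := nzQ s; apply: contraNneq => U0.
  by rewrite QU U0 meval0.
have /mpoly_nonroot[w] : (\prod_t R t) * \prod_s U s != 0.
  by rewrite mulf_neq0 //; apply/prodf_neq0.
rewrite mevalM !rmorph_prod mulf_eq0 negb_or.
move=> /andP[/prodf_neq0 Rw /prodf_neq0 Uw].
exists (fun z => w (enum_rank z)); split=> [t v fv | s].
  have /eqP[] := Rw t isT; rewrite -[RHS](R0 t v); apply: meval_eq => i.
  by rewrite fv enum_valK.
rewrite QU; apply: contra (Uw s isT) => /eqP <-; apply/eqP/meval_eq => i /=.
by rewrite enum_valK.
Qed.

(** * The family of forms *)

Section PowerLinearForms.
Variables (k : fieldType) (m d : nat).
Implicit Types (A : 'I_m -> 'I_m -> k) (x : 'I_m -> k).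

(** These forms contain [x_j ^ d] and [x_j ^ (d - 1) x_l]: enough to be generically
smooth in every characteristic, yet few enough to control their derivatives
along every line. *)
Definition powlin A : {mpoly k[m]} :=
  \sum_j \sum_l A j l *: ('X_j ^+ d.-1 * 'X_l).

Definition powlin_val A x : k := \sum_j \sum_l A j l * (x j ^+ d.-1 * x l).

Definition powlin_der A x (l : 'I_m) : k :=
  \sum_j A j l * x j ^+ d.-1
  + \sum_j A l j * ((x l ^+ d.-2 *+ d.-1) * x j).

Lemma meval_powlin A x : (powlin A).@[x] = powlin_val A x.
Proof.
rewrite raddf_sum; apply: eq_bigr => j _; rewrite /= raddf_sum.
by apply: eq_bigr => l _; rewrite /= mevalZ mevalM rmorphXn /= !mevalXU.
Qed.

Lemma mderiv_Xn (j l : 'I_m) e :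
  ('X_j ^+ e : {mpoly k[m]})^`M(l) = ('X_j ^+ e.-1) *+ (e * (j == l)).
Proof.
case: e => [|e]; first by rewrite expr0 mul0n mulr0n -mpolyC1 mderivC.
rewrite mpolyXn mderivX mulmnE mnm1E /=.
have [->|_] := eqVneq; last by rewrite !muln0 scale0r.
rewrite !muln1 mul1n scaler_nat mpolyXn; congr ('X_[_] *+ _).
by apply/mnmP => i; rewrite !(mnmBE, mulmnE, mnm1E) mulnS addKn.
Qed.

Lemma mderiv_powlin A l x : ((powlin A)^`M(l)).@[x] = powlin_der A x l.
Proof.
have -> : (powlin A)^`M(l) = \sum_j \sum_i
    A j i *: ('X_j ^+ d.-2 *+ (d.-1 * (j == l)) * 'X_i
              + 'X_j ^+ d.-1 *+ (i == l)).
  rewrite raddf_sum; apply: eq_bigr => j _; rewrite /= raddf_sum.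
  apply: eq_bigr => i _; rewrite /= mderivZ mderivM mderiv_Xn; congr (_ *: (_ + _)).
  by rewrite -[X in X^`M(l)]expr1 mderiv_Xn expr0 mul1n mulr_natr.
rewrite /powlin_der addrC.
have -> : \sum_j A l j * (x l ^+ d.-2 *+ d.-1 * x j) =
    \sum_j \sum_i A j i * (x j ^+ d.-2 *+ (d.-1 * (j == l)) * x i).
  rewrite [RHS](bigD1 l) //= [X in _ + X]big1 ?addr0 => [|j /negPf ne_jl].
    by apply: eq_bigr => i _; rewrite eqxx muln1.
  by rewrite big1 // => i _; rewrite ne_jl muln0 mulr0n mul0r mulr0.
rewrite -big_split raddf_sum; apply: eq_bigr => j _ /=.
have -> : A j l * x j ^+ d.-1 = \sum_i A j i * (x j ^+ d.-1 *+ (i == l)).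
  rewrite [RHS](bigD1 l) //= big1 ?addr0 ?eqxx // => i /negPf->.
  by rewrite mulr0n mulr0.
rewrite -big_split raddf_sum; apply: eq_bigr => i _ /=.
by rewrite mevalZ mevalD mevalM !mevalMn !rmorphXn /= !mevalXU mulrDr.
Qed.

Lemma powlin_homog A : (0 < d)%N -> powlin A \is d.-homog.
Proof.
move=> d_gt0; rewrite /powlin; apply: rpred_sum => j _; apply: rpred_sum => l _.
have hX i : ('X_i : {mpoly k[m]}) \is 1.-homog by rewrite dhomogX /= mdeg1.
have := dhomogM (dhomogMn d.-1 (hX j)) (hX l).
by rewrite mul1n addn1 prednK //; apply: dhomogZ.
Qed.

(** On the chart where coordinate [i] is [1], row [i] of [A] lists the coefficients
of an arbitrary affine function, which is added to the rest of the form. *)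
Lemma powlin_val_chart A x i : x i = 1 ->
  powlin_val A x =
    powlin_val (fun j l => if j == i then 0 else A j l) x + \sum_l A i l * x l.
Proof.
move=> xi; rewrite /powlin_val (bigD1 i) //= [in RHS](bigD1 i) //= eqxx.
rewrite [X in _ = X + _ + _]big1 => [|l _]; last by rewrite mul0r.
rewrite add0r addrC xi expr1n; congr (_ + _).
  by apply: eq_bigr => j /negPf ne_ji; apply: eq_bigr => l _; rewrite ne_ji.
by apply: eq_bigr => l _; rewrite mul1r.
Qed.

Lemma powlin_der_chart A x i l : x i = 1 -> l != i ->
  powlin_der A x l =
    powlin_der (fun j l => if j == i then 0 else A j l) x l + A i l.
Proof.
move=> xi /negPf ne_li; rewrite /powlin_der ne_li addrAC; congr (_ + _).
rewrite (bigD1 i) //= [in RHS](bigD1 i) //= eqxx xi expr1n mul0r mulr1 add0r.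
by rewrite addrC; congr (_ + _); apply: eq_bigr => j /negPf->.
Qed.

End PowerLinearForms.

Section PowlinPolyfun.
Variables (k : fieldType) (J : finType) (m d : nat).
Variables (A : 'I_m -> 'I_m -> (J -> k) -> k) (x : 'I_m -> (J -> k) -> k).
Hypotheses (polA : forall j l, polyfun (A j l)).
Hypotheses (polx : forall j, polyfun (x j)).

Lemma polyfun_powlin_val :
  polyfun (fun v => powlin_val d (fun j l => A j l v) (fun j => x j v)).
Proof.
do 2!apply: polyfun_sum => ?.
by apply: polyfunM => //; apply: polyfunM => //; apply: polyfunX.
Qed.

Lemma polyfun_powlin_der (l : 'I_m) :
  polyfun (fun v => powlin_der d (fun j l => A j l v) (fun j => x j v) l).
Proof.
apply: polyfunD; apply: polyfun_sum => j; apply: polyfunM => //.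
  exact: polyfunX.
apply: polyfunM => //.
suff : polyfun (fun v => x l v ^+ d.-2 * (d.-1)%:R).
  by case=> P xP; exists P => v; rewrite -xP mulr_natr.
by apply: polyfunM (polyfun_cst _ _); apply: polyfunX.
Qed.

End PowlinPolyfun.

(** * Smooth members *)

Section SingularParameters.
Variables (k : fieldType) (c m : nat) (d : 'I_c -> nat).

Let I : finType := ('I_c * 'I_m * 'I_m)%type.

Variables (s : 'I_m) (r : 'I_c).

(** The parameters of a singular system are stored in the slots of its coefficients
[A i j l]: the coordinate [l] of the singular point in the slot [(r, s, l)], the
coefficient of row [i] in the expression of row [r] (up to sign) in the slot
[(i, s, s)].  The slot [(r, s, s)] is left over, which makes one parameter less
than there are coefficients. *)
Definition sing_slots : finType := {z : I | z != (r, s, s)}.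

Definition slot (v : sing_slots -> k) (z : I) : k :=
  if insub z is Some z' then v z' else 0.

Definition sing_point v (l : 'I_m) : k := if l == s then 1 else slot v (r, s, l).

Definition sing_rest v (i : 'I_c) (j l : 'I_m) : k :=
  if j == s then 0 else slot v (i, j, l).

Definition sing_row v (i : 'I_c) (l : 'I_m) : k :=
  if i != r then slot v (i, s, l) else
  - (powlin_der (d r) (sing_rest v r) (sing_point v) l
     + \sum_(i | i != r) slot v (i, s, s) *
         (powlin_der (d i) (sing_rest v i) (sing_point v) l + slot v (i, s, l))).

(** The coefficients [(r, s, l)] with [l != s] are solved for by means of the
relation between rows, the [(i, s, s)] by means of the equations of the
point; the others are parameters. *)
Definition sing_coef v (z : I) : k :=
  let: (i, j, l) := z in
  if j != s then slot v z else
  if l != s then sing_row v i l else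
  - (powlin_val (d i) (sing_rest v i) (sing_point v)
     + \sum_(l | l != s) sing_row v i l * sing_point v l).

Lemma card_sing_slots : (#|sing_slots| < #|I|)%N.
Proof.
rewrite card_sig; have -> : #|[pred z : I | z != (r, s, s)]| = #|predC1 (r, s, s)|.
  exact: eq_card.
by rewrite cardC1 prednK //; apply/card_gt0P; exists (r, s, s).
Qed.

Lemma polyfun_sing_coef z : polyfun (fun v => sing_coef v z).
Proof.
have pslot z' : polyfun (fun v => slot v z').
  rewrite /slot; case: insubP => [u _ _|_]; first exact: polyfun_var.
  exact: polyfun_cst.
have ppt l : polyfun (fun v => sing_point v l).
  by rewrite /sing_point; case: eqP => // _; apply: polyfun_cst.
have prest i j l : polyfun (fun v => sing_rest v i j l).
  by rewrite /sing_rest; case: eqP => // _; apply: polyfun_cst.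
have pder i l : polyfun (fun v =>
    powlin_der (d i) (sing_rest v i) (sing_point v) l).
  exact: (polyfun_powlin_der _ (prest i) ppt).
have prow i l : polyfun (fun v => sing_row v i l).
  rewrite /sing_row; case: eqP => _ //=; apply: polyfunN; apply: polyfunD => //.
  by apply: polyfun_sum => j; apply: polyfunM => //; apply: polyfunD.
case: z => [[i j] l]; rewrite /sing_coef; do 2!case: eqP => _ //=.
apply: polyfunN; apply: polyfunD; first exact: (polyfun_powlin_val _ (prest i) ppt).
by apply: polyfun_sum => l'; apply: polyfunM.
Qed.

(** At a singular point with coordinate [s] equal to [1], row [r] of the Jacobian
matrix is a combination of the others; this determines the coefficients
[(r, s, l)], and the vanishing of the forms then determines those in
[(i, s, s)]. *)
Lemma sing_coef_onto (A : 'I_c -> 'I_m -> 'I_m -> k) (x : 'I_m -> k)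
    (u : 'I_c -> k) :
  x s = 1 -> u r != 0 ->
  (forall i, powlin_val (d i) (A i) x = 0) ->
  (forall l, \sum_i u i * powlin_der (d i) (A i) x l = 0) ->
  exists v, forall i j l, sing_coef v (i, j, l) = A i j l.
Proof.
move=> xs ur val0 der0.
pose w (z : I) := let: (i, j, l) := z in
  if j != s then A i j l else
  if i == r then x l else if l == s then u i / u r else A i s l.
pose v (z : sing_slots) := w (val z).
have slotE z : z != (r, s, s) -> slot v z = w z by rewrite /slot => nz; rewrite insubT.
have ptE : sing_point v =1 x.
  move=> l; rewrite /sing_point; have [->|ne_ls] := eqVneq l s; first by rewrite xs.
  by rewrite slotE ?xpair_eqE ?(negPf ne_ls) ?andbF //= !eqxx.
have restE i j l : sing_rest v i j l = if j == s then 0 else A i j l.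
  rewrite /sing_rest; have [//|ne_js] := eqVneq j s.
  by rewrite slotE ?xpair_eqE ?(negPf ne_js) ?andbF //= ne_js.
have valE i : powlin_val (d i) (sing_rest v i) (sing_point v) =
    powlin_val (d i) (fun j l => if j == s then 0 else A i j l) x.
  by do 2!apply: eq_bigr => ? _; rewrite restE !ptE.
have derE i l : powlin_der (d i) (sing_rest v i) (sing_point v) l =
    powlin_der (d i) (fun j l => if j == s then 0 else A i j l) x l.
  by congr (_ + _); apply: eq_bigr => ? _; rewrite restE !ptE.
have lamE i : i != r -> slot v (i, s, s) = u i / u r.
  by move=> ne_ir; rewrite slotE ?xpair_eqE ?(negPf ne_ir) //= !eqxx (negPf ne_ir).
have coefE i l : i != r -> l != s -> slot v (i, s, l) = A i s l.
  move=> ne_ir ne_ls; rewrite slotE ?xpair_eqE ?(negPf ne_ir) //=.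
  by rewrite eqxx (negPf ne_ir) (negPf ne_ls).
have rowE i l : l != s -> sing_row v i l = A i s l.
  move=> ne_ls; rewrite /sing_row; case: eqVneq => [->|ne_ir] /=; last exact: coefE.
  have := der0 l; rewrite (bigD1 r) //= (powlin_der_chart _ _ xs ne_ls) derE.
  under [in X in _ -> X]eq_bigr => i' ne_i'r.
    rewrite lamE // coefE // derE -(powlin_der_chart _ _ xs ne_ls) mulrAC; over.
  rewrite -mulr_suml => /eqP; rewrite addrC addr_eq0 => /eqP->.
  by rewrite mulNr mulrC mulKf // opprD opprK addKr.
exists v => i j l; rewrite /sing_coef.
have [->|ne_js] := eqVneq j s => /=; last first.
  by rewrite slotE ?xpair_eqE ?(negPf ne_js) ?andbF //= ne_js.
have [->|ne_ls] := eqVneq l s => /=; last exact: rowE.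
apply/eqP; rewrite eq_sym -addr_eq0 -[X in _ == X](val0 i).
rewrite (powlin_val_chart (d i) (A i) xs) [in X in _ == X](bigD1 s) //=.
rewrite xs mulr1 valE addrCA.
apply/eqP; congr (_ + _); congr (_ + _).
by apply: eq_bigr => l' ne_l's; rewrite rowE ?ptE.
Qed.

End SingularParameters.

Lemma powlin_val_scale (k : fieldType) (m d : nat) (A : 'I_m -> 'I_m -> k)
    (x : 'I_m -> k) t : (0 < d)%N ->
  powlin_val d A (fun j => t * x j) = t ^+ d * powlin_val d A x.
Proof.
move=> d_gt0; rewrite mulr_sumr; apply: eq_bigr => j _.
rewrite mulr_sumr; apply: eq_bigr => l _.
rewrite -[X in t ^+ X](prednK d_gt0) exprSr exprMn.
by rewrite [RHS]mulrCA mulrACA.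
Qed.

Lemma powlin_der_scale (k : fieldType) (m d : nat) (A : 'I_m -> 'I_m -> k)
    (x : 'I_m -> k) t l :
  powlin_der d A (fun j => t * x j) l = t ^+ d.-1 * powlin_der d A x l.
Proof.
rewrite mulrDr !mulr_sumr; congr (_ + _); apply: eq_bigr => j _.
  by rewrite exprMn mulrCA.
case: d => [|[|d]] /=; rewrite ?mulr0n ?mul0r ?mulr0 //.
rewrite exprMn exprSr [RHS]mulrCA -!mulrnAr -!mulrA.
by congr (_ * (_ * _)); rewrite mulrCA.
Qed.

(** Each way of being singular (a coordinate [s] which does not vanish at the
singular point, and a row [r] of the Jacobian matrix depending on the others)
is parametrized by one parameter less than there are coefficients, so a general
system avoids all of them. *)
Lemma exists_smooth_powlin (k : closedFieldType) (n c : nat) (d : c.-tuple nat) :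
  (forall i : 'I_c, (0 < tnth d i)%N) ->
  exists A : 'I_c -> 'I_n.+1 -> 'I_n.+1 -> k,
    smooth_complete_intersection d (fun i => powlin (tnth d i) (A i)).
Proof.
move=> d_gt0; pose I : finType := ('I_c * 'I_n.+1 * 'I_n.+1)%type.
pose Q (i : 'I_c) (a : I -> k) := \sum_j \sum_l a (i, j, l).
have polQ i : polyfun (Q i).
  by do 2!apply: polyfun_sum => ?; apply: polyfun_var.
have nzQ i : exists a, Q i a != 0.
  exists (fun z => ((z.1.2 == ord0) && (z.2 == ord0))%:R).
  rewrite /Q (bigD1 ord0) //= (bigD1 ord0) //= !big1 ?addr0 ?oner_eq0 //.
    by move=> j /negPf ne_j0; rewrite big1 // => l _; rewrite ne_j0.
  by move=> l /negPf ne_l0; rewrite ne_l0.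
(* [Q i] is the value of the form [i] at (1, ..., 1); it keeps the form nonzero. *)
have [a [regular_a nzQa]] := avoid_polynomial_images
  (fun t : 'I_n.+1 * 'I_c => card_sing_slots t.1 t.2)
  (fun t z => polyfun_sing_coef k (tnth d) t.1 t.2 z) polQ nzQ.
exists (fun i j l => a (i, j, l)); split=> [i | x nz_x Fx].
  split; last exact/powlin_homog/d_gt0.
  apply: contraNneq (nzQa i) => F0.
  have := meval_powlin (tnth d i) (fun j l => a (i, j, l)) (fun=> 1).
  rewrite F0 meval0 => ->; apply/eqP; do 2!apply: eq_bigr => ? _.
  by rewrite expr1n !mulr1.
apply/eqP; rewrite -/(row_free _) -kermx_eq0; apply/rowV0P => u /sub_kermxP uJ.
apply/eqP/contraT => /rV0Pn[r nz_ur].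
have /rV0Pn[s nz_xs] := nz_x.
pose y j := (x 0 s)^-1 * x 0 j.
have xy j : x 0 j = x 0 s * y j by rewrite mulVKf.
have Jx i l : jacobian (fun i => powlin (tnth d i) (fun j l => a (i, j, l))) x i l
    = x 0 s ^+ (tnth d i).-1 * powlin_der (tnth d i) (fun j l => a (i, j, l)) y l.
  rewrite mxE /mevalv mderiv_powlin -powlin_der_scale.
  by congr (_ + _); apply: eq_bigr => j _; rewrite -!xy.
(* The rows of the Jacobian matrix scale by different powers of [x 0 s] when the
   point is normalized, and the relation [u] scales accordingly. *)
have [||i|l|v va] := @sing_coef_onto k c n.+1 (tnth d) s r
    (fun i j l => a (i, j, l)) y (fun i => u 0 i * x 0 s ^+ (tnth d i).-1).
- by rewrite /y mulVf.
- by rewrite mulf_neq0 ?expf_neq0.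
- have := Fx i; rewrite /mevalv meval_powlin.
  have -> : powlin_val (tnth d i) (fun j l => a (i, j, l)) (fun j => x 0 j) =
      x 0 s ^+ tnth d i * powlin_val (tnth d i) (fun j l => a (i, j, l)) y.
    rewrite -powlin_val_scale //; do 2!apply: eq_bigr => ? _.
    by rewrite -!xy.
  by move/eqP; rewrite mulf_eq0 expf_eq0 (negPf nz_xs) andbF => /eqP.
- have := congr1 (fun B : 'rV_ _ => B 0 l) uJ; rewrite !mxE => {2}<-.
  by apply: eq_bigr => i _; rewrite Jx mulrA.
by case: (regular_a (s, r) v) => -[[i j] l]; exact: va.
Qed.

(** * Line bundles of negative degree on the projective line *)

Section NegativeDegree.
Variable k : closedFieldType.

(** Points of the projective line are encoded as [option k], with [None] at
infinity; normalized coordinates turn sections of line bundles into functions. *)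
Definition hcoord (o : option k) : 'rV[k]_2 :=
  \row_j (if o is Some u then if j == 0 then u else 1 else (j == 0)%:R).

Lemma hcoord_neq0 o : hcoord o != 0.
Proof.
apply/rV0Pn; case: o => [u|]; [exists 1 | exists 0]; rewrite !mxE ?eqxx ?oner_eq0 //=.
Qed.

Definition heval (G : {mpoly k[2]}) (o : option k) : k := mevalv G (hcoord o).

Lemma hevalXnM (i : 'I_2) e G o :
  heval ('X_i ^+ e * G) o = hcoord o 0 i ^+ e * heval G o.
Proof. by rewrite /heval /mevalv mevalM rmorphXn /= mevalXU. Qed.

Lemma hevalD G G' o : heval (G + G') o = heval G o + heval G' o.
Proof. exact: mevalD. Qed.

(** [f] is, near [o], a regular section of the line bundle O(-e), evaluated at the
coordinates [hcoord]. *)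
Definition regular_at (e : nat) (f : option k -> k) (o : option k) : Prop :=
  exists m (H G : {mpoly k[2]}),
    [/\ H \is (m + e).-homog, G \is m.-homog, heval H o != 0
      & forall o', heval H o' != 0 -> f o' = heval G o' / heval H o'].

Definition dehomog (G : {mpoly k[2]}) : {poly k} :=
  \sum_(m <- msupp G) G@_m *: 'X^(m 0).

Lemma horner_dehomog G u : (dehomog G).[u] = heval G (Some u).
Proof.
rewrite /dehomog horner_sum /heval /mevalv mevalE; apply: eq_bigr => m _.
by rewrite hornerZ hornerXn big_ord_recl big_ord1 !mxE /= expr1n mulr1.
Qed.

Lemma size_dehomog G m : G \is m.-homog -> (size (dehomog G) <= m.+1)%N.
Proof.
move=> /dhomogP homG; apply: leq_trans (size_sum _ _ _) _.
apply/bigmax_leqP_seq => u /homG /= um _; apply: leq_trans (size_scale_leq _ _) _.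
by rewrite size_polyXn ltnS -um mdegE (bigD1 0) //= leq_addr.
Qed.

Lemma coef_dehomog G m : G \is m.-homog -> (dehomog G)`_m = heval G None.
Proof.
move=> /dhomogP homG; rewrite /dehomog coef_sum /heval /mevalv mevalE.
apply: eq_big_seq => u /homG /= um.
rewrite coefZ coefXn big_ord_recl big_ord1 !mxE /= expr1n mul1r expr0n.
congr (_ * _%:R); rewrite -um mdegE big_ord_recl big_ord1.
by rewrite -[X in (_ == X)]addn0 eqn_add2l eq_sym.
Qed.

(** A line bundle of negative degree has no nonzero section: a rational function
in lowest terms which is regular on the affine line has no pole, so it is a
polynomial, and it is [0] when it vanishes at infinity. *)
Lemma regular_negative_eq0 e (f : option k -> k) :
  (0 < e)%N -> (forall o, regular_at e f o) -> forall o, f o = 0.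
Proof.
move=> e_gt0 regf.
have [m0 [H0 [G0 [homH0 homG0 H0inf f0]]]] := regf None.
pose g0 := dehomog G0; pose h0 := dehomog H0.
have szh0 : (m0.+1 < size h0)%N.
  rewrite ltnNge; apply: contra H0inf => le_sz.
  rewrite -(coef_dehomog homH0) nth_default //; apply: leq_trans le_sz _.
  by rewrite -addn1 leq_add2l.
have nz_h0 : h0 != 0 by rewrite -size_poly_gt0 (leq_trans _ szh0).
have szg0 : (size g0 < size h0)%N.
  exact: leq_ltn_trans (size_dehomog homG0) szh0.
(* Two local expressions of [f] agree at almost all points, hence as fractions. *)
have cross G1 H1 :
    (exists u, heval H1 (Some u) != 0) ->
    (forall o', heval H1 o' != 0 -> f o' = heval G1 o' / heval H1 o') ->
    g0 * dehomog H1 = dehomog G1 * h0.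
  case=> u nz_u f1; have nz_h1 : dehomog H1 != 0.
    by apply: contraNneq nz_u => h10; rewrite -horner_dehomog h10 horner0.
  apply/eqP; rewrite -subr_eq0; apply/negPn/negP => nz_diff.
  have: (g0 * dehomog H1 - dehomog G1 * h0) * (h0 * dehomog H1) != 0.
    by rewrite !mulf_neq0.
  case/closed_nonrootP=> x; rewrite rootE !hornerE !mulf_eq0 !negb_or.
  rewrite /g0 /h0 !horner_dehomog -andbA => /and3P[nz_d nz_0x nz_1x].
  case/eqP: nz_d.
  have := f1 _ nz_1x; rewrite f0 // => /eqP; rewrite eqr_div // => /eqP->.
  by rewrite subrr.
pose D := gcdp g0 h0.
have nz_D : D != 0 by rewrite gcdp_eq0 negb_and nz_h0 orbT.
have g0D : g0 = (g0 %/ D) * D by rewrite divpK // dvdp_gcdl.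
have h0D : h0 = (h0 %/ D) * D by rewrite divpK // dvdp_gcdr.
have cop : coprimep (h0 %/ D) (g0 %/ D).
  by rewrite coprimep_sym coprimep_div_gcd // nz_h0 orbT.
have noroot : size (h0 %/ D) == 1%N.
  apply/negPn/negP => /closed_rootP[u root_u].
  have [m1 [H1 [G1 [_ _ H1u f1]]]] := regf (Some u).
  have := cross G1 H1 (ex_intro _ u H1u) f1.
  rewrite g0D h0D mulrAC mulrA => /(mulIf nz_D) /(congr1 (horner^~ u)).
  rewrite !hornerM horner_dehomog (rootP root_u) mulr0 => /eqP.
  by rewrite mulf_eq0 (negPf H1u) orbF (negPf (coprimep_root cop root_u)).
have g00 : g0 = 0.
  apply/eqP; rewrite g0D mulf_eq0 (negPf nz_D) orbF -size_poly_eq0 -leqn0 -ltnS.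
  rewrite -(eqP noroot); have [->|nz_g] := eqVneq (g0 %/ D) 0.
    by rewrite size_poly0 (eqP noroot).
  rewrite -(ltn_add2r (size D).-1); have nz_h : h0 %/ D != 0.
    by rewrite -size_poly_gt0 (eqP noroot).
  move: szg0; rewrite {1}g0D {1}h0D !size_mul // -!subn1 !addnBA // ?size_poly_gt0 //.
case=> [u|].
  have [m1 [H1 [G1 [_ _ H1u f1]]]] := regf (Some u).
  have /esym/eqP := cross G1 H1 (ex_intro _ u H1u) f1.
  rewrite g00 mul0r mulf_eq0 (negPf nz_h0) orbF => /eqP g10.
  by rewrite f1 // -horner_dehomog g10 horner0 mul0r.
by rewrite f0 // -(coef_dehomog homG0) -/g0 g00 coef0 mul0r.
Qed.

End NegativeDegree.

(** * The missing monomial *)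

Section MissingMonomial.
Variables (k : fieldType) (q r : nat).

(** A form of degree [q + r + 2] splits in this way exactly when it lacks the
monomial [X^(q+1) Y^(r+1)]. *)
Definition splits (G : {mpoly k[2]}) : Prop :=
  exists A B : {mpoly k[2]}, [/\ A \is r.-homog, B \is q.-homog
    & G = 'X_0 ^+ q.+2 * A + 'X_1 ^+ r.+2 * B].

Lemma splits0 : splits 0.
Proof. by exists 0, 0; rewrite !dhomog0 !mulr0 addr0. Qed.

Lemma splitsD G G' : splits G -> splits G' -> splits (G + G').
Proof.
move=> [A [B [hA hB ->]]] [A' [B' [hA' hB' ->]]].
exists (A + A'), (B + B'); split; try exact: dhomogD.
by rewrite !mulrDr addrACA.
Qed.

Lemma splitsZ z G : splits G -> splits (z *: G).
Proof.
move=> [A [B [hA hB ->]]]; exists (z *: A), (z *: B).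
by split; rewrite ?dhomogZ // scalerDr !scalerAr.
Qed.

Lemma splits_sum (T : finType) (F : T -> {mpoly k[2]}) :
  (forall t, splits (F t)) -> splits (\sum_t F t).
Proof.
by move=> sF; elim/big_ind: _ => //; [apply: splits0 | apply: splitsD].
Qed.

Lemma dhomog_binary_mon i j :
  ('X_0 ^+ i * 'X_1 ^+ j : {mpoly k[2]}) \is (i + j).-homog.
Proof.
have hX (l : 'I_2) : ('X_l : {mpoly k[2]}) \is 1.-homog by rewrite dhomogX /= mdeg1.
by rewrite -[i in (i + _)%N]mul1n -[j in (_ + j)%N]mul1n dhomogM ?dhomogMn.
Qed.

Lemma splits_mon z i j : (i + j = q.+1 + r.+1)%N -> (j = r.+1 -> z = 0) ->
  splits (z *: ('X_0 ^+ i * 'X_1 ^+ j)).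
Proof.
move=> ij_eq z0;
have [lt_jb | gt_jb | /z0->] := ltngtP j r.+1; last by rewrite scale0r; apply: splits0.
  have le_i : (q.+2 <= i)%N.
    by rewrite -(leq_add2r j) ij_eq addSnnS leq_add2l.
  apply: splitsZ; exists ('X_0 ^+ (i - q.+2) * 'X_1 ^+ j), 0.
  rewrite dhomog0 mulr0 addr0 mulrA -exprD subnKC //; split=> //.
  have -> : r = (i - q.+2 + j)%N.
    by rewrite addnBAC // ij_eq -addSnnS addKn.
  exact: dhomog_binary_mon.
apply: splitsZ; exists 0, ('X_0 ^+ i * 'X_1 ^+ (j - r.+2)).
rewrite dhomog0 mulr0 add0r mulrCA -exprD subnKC //; split=> //.
have -> : q = (i + (j - r.+2))%N.
  by rewrite addnBA // ij_eq addSnnS addnK.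
exact: dhomog_binary_mon.
Qed.

End MissingMonomial.

Section FormsOnALine.
Variables (k : fieldType) (n : nat) (L : 'M[k]_(2, n)).
Implicit Types (d : nat) (A : 'I_n -> 'I_n -> k).

Definition line_coord (j : 'I_n) : {mpoly k[2]} := L 0 j *: 'X_0 + L 1 j *: 'X_1.

(** The restriction of a partial derivative to the line, as a polynomial in the
coordinates of the line, so that its monomials can be examined. *)
Definition line_der d A (l : 'I_n) : {mpoly k[2]} :=
  \sum_j A j l *: line_coord j ^+ d.-1
  + \sum_j A l j *: ((line_coord l ^+ d.-2 *+ d.-1) * line_coord j).

Lemma meval_line_coord j (y : 'rV_2) : mevalv (line_coord j) y = (y *m L) 0 j.
Proof.
rewrite /mevalv mevalD !mevalZ !mevalXU mxE big_ord_recl big_ord1.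
by rewrite ![y 0 _ * _]mulrC; congr (_ + L _ j * y 0 _); apply: val_inj.
Qed.

Lemma meval_line_der d A l (y : 'rV_2) :
  mevalv (line_der d A l) y = powlin_der d A (fun j => (y *m L) 0 j) l.
Proof.
rewrite /mevalv mevalD !raddf_sum; congr (_ + _); apply: eq_bigr => j _ /=.
  by rewrite mevalZ rmorphXn /= [_.@[_]]meval_line_coord.
rewrite mevalZ mevalM mevalMn rmorphXn /= -!/(mevalv _ _).
by rewrite !meval_line_coord.
Qed.

Lemma line_coord_homog j : line_coord j \is 1.-homog.
Proof. by apply: dhomogD; apply: dhomogZ; rewrite dhomogX /= mdeg1. Qed.

Lemma line_der_homog d A l : line_der d A l \is (d.-1).-homog.
Proof.
apply: dhomogD; apply: rpred_sum => j _; apply: dhomogZ.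
  by have := dhomogMn d.-1 (line_coord_homog j); rewrite mul1n.
case: d => [|[|d]] /=; rewrite ?mulr0n ?mul0r ?dhomog0 //.
suff: line_coord l ^+ d *+ d.+1 * line_coord j \is (d + 1).-homog by rewrite addn1.
rewrite dhomogM ?line_coord_homog // rpredMn //.
by have := dhomogMn d (line_coord_homog l); rewrite mul1n.
Qed.

Lemma binary_linear_exp (s t : k) e :
  (s *: 'X_0 + t *: 'X_1) ^+ e = \sum_(i < e.+1)
    (s ^+ (e - i) * t ^+ i *+ 'C(e, i)) *: ('X_0 ^+ (e - i) * 'X_1 ^+ i)
    :> {mpoly k[2]}.
Proof.
rewrite exprDn; apply: eq_bigr => i _.
by rewrite !exprZn -scalerAl -scalerAr scalerA scalerMnl.
Qed.

(** The missing monomial has coefficient [0] in the power [l ^ N] of any linear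
form, because its binomial coefficient is [0], and hence also in the
polarization [N l ^ (N - 1) l'] of this power. *)
Lemma splits_line_der d A l q r : d.-1 = (q.+1 + r.+1)%N ->
  'C(q.+1 + r.+1, r.+1)%:R = 0 :> k -> splits q r (line_der d A l).
Proof.
move=> dE bin0; apply: splitsD; apply: splits_sum => j; apply: splitsZ.
  rewrite dE binary_linear_exp; apply: splits_sum => i; apply: splits_mon.
    by rewrite subnK // -ltnS.
  by move=> ->; rewrite -mulr_natr bin0 mulr0.
have -> : d.-2 = (q + r.+1)%N by rewrite dE.
rewrite dE {1}/line_coord binary_linear_exp -mulr_natr -mulrA mulr_suml.
apply: splits_sum => i; rewrite /line_coord mulr_natl mulrnDl mulrDr.
have le_i : (i <= q + r.+1)%N by rewrite -ltnS.
set N := (q + r.+1)%N in i le_i *; set z := _ *+ 'C(N, i).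
have zN : i = r.+1 :> nat \/ i = r :> nat -> z *+ N.+1 = 0.
  suff bin_i : i = r.+1 :> nat \/ i = r :> nat -> ('C(N, i) * N.+1)%:R = 0 :> k.
    by move/bin_i => bin_0; rewrite /z -mulrnA -mulr_natr bin_0 mulr0.
  have NE : N.+1 = (q.+1 + r.+1)%N by [].
  case=> ->; rewrite mulnC -[N in 'C(N, _)]/(N.+1.-1) mul_bin_diag.
    by rewrite mul_bin_left NE natrM bin0 mulr0.
  by rewrite NE natrM bin0 mulr0.
rewrite -!scaler_nat !scalerA -!scalerAr -!scalerAl !scalerA.
rewrite [_ * 'X_0]mulrAC -exprSr -[_ * 'X_1]mulrA -exprSr.
apply: splitsD; apply: splits_mon.
- by rewrite addSn subnK.
- by move=> iE; rewrite mulrAC mulr_natl [_ *+ _](zN (or_introl iE)) mul0r.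
- by rewrite addnS subnK.
- by case=> iE; rewrite mulrAC mulr_natl [_ *+ _](zN (or_intror iE)) mul0r.
Qed.

End FormsOnALine.

Lemma powlin_euler (k : fieldType) (m d : nat) (A : 'I_m -> 'I_m -> k)
    (x : 'I_m -> k) : (0 < d)%N ->
  \sum_l powlin_der d A x l * x l = powlin_val d A x *+ d.
Proof.
move=> d_gt0; rewrite -[in RHS](prednK d_gt0) mulrS.
under eq_bigr => l _ do rewrite mulrDl.
rewrite big_split; congr (_ + _).
  rewrite /powlin_val exchange_big; apply: eq_bigr => l _; rewrite mulr_suml.
  by apply: eq_bigr => j _; rewrite mulrA.
rewrite -mulr_natr mulr_suml; apply: eq_bigr => l _; rewrite !mulr_suml.
apply: eq_bigr => j _; case: (d.-1) => [|e]; first by rewrite mulr0n !mul0r !mulr0 mul0r.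
rewrite mulr_natr mulrnAl mulrnAr mulrnAl; congr (_ *+ _).
by rewrite -mulrA exprSr mulrAC.
Qed.

(** Let [Q] be the least power of [p] not dividing [d]; nonspecialness says that
[Q < d].  Then the identity [Q * 'C(d, Q) = d * 'C(d - 1, Q - 1)] forces [p] to
divide the last binomial coefficient.  In the statement [Q = q + 2]. *)
Lemma nonspecial_binomial (p d : nat) : prime p -> (p <= d)%N ->
  ~ (((p %| d)%N -> p_special p d) /\ (coprime p d -> p_special p d.+1)) ->
  exists q r, d = (q.+1 + r.+1).+1 /\ (p %| 'C(q.+1 + r.+1, r.+1))%N.
Proof.
move=> p_pr le_pd nspec; have p_gt1 := prime_gt1 p_pr; have p_gt0 := prime_gt0 p_pr.
have d_gt0 : (0 < d)%N by apply: leq_trans le_pd.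
(* When [d] is prime to [p], [v = 0] works: [p <= d] and [p] does not divide [d]. *)
have [v le_vd ndiv] : exists2 v, (p ^ v.+1 <= d)%N & ~~ (p ^ v.+1 %| d)%N.
  have [pd | npd] := boolP (p %| d)%N; last by exists 0; rewrite expn1.
  exists (logn p d); last by rewrite pfactor_dvdn // ltnn.
  have le_pe : (p <= d`_p^')%N.
    rewrite leqNgt; apply/negP => lt_ep; apply: nspec; split=> [_|].
      by rewrite /p_special lt_ep part_gt0.
    by rewrite prime_coprime // pd.
  by rewrite -[X in (_ <= X)%N](partnC p d_gt0) p_part expnSr leq_mul2l le_pe orbT.
have lt_vd : (p ^ v.+1 < d)%N.
  by rewrite ltn_neqAle le_vd andbT; apply: contraNneq ndiv => ->; rewrite dvdnn.
have lt1v : (1 < p ^ v.+1)%N by rewrite -(expn0 p) ltn_exp2l.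
have [q qE] : exists q, (p ^ v.+1 = q.+2)%N.
  by exists (p ^ v.+1).-2; rewrite -subn2 -[RHS]addn2 subnK.
have [r dE] : exists r, d = (q.+1 + r.+1).+1.
  by exists (d - q.+3)%N; rewrite -addSn addnS -addSn subnKC // -qE.
exists q, r; split=> //; rewrite -bin_sub ?leq_addl // addnK.
apply: contraR ndiv => npC; rewrite qE.
have coC : coprime q.+2 'C(q.+1 + r.+1, q.+1).
  by rewrite -qE coprimeXl // prime_coprime.
rewrite -(Gauss_dvdl _ coC) {1}dE.
by have := mul_bin_diag (q.+1 + r.+1).+1 q.+1; rewrite /= => ->; apply: dvdn_mulr.
Qed.

(** * Global sections along a line *)

Lemma dhomog_prod_seq (R : idomainType) (m : nat) (T : Type) (s : seq T)
    (P : T -> {mpoly R[m]}) (e : T -> nat) :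
  (forall t, P t \is (e t).-homog) ->
  \prod_(t <- s) P t \is (\sum_(t <- s) e t).-homog.
Proof.
move=> homP; elim: s => [|t s IHs]; first by rewrite !big_nil dhomog1.
by rewrite !big_cons dhomogM.
Qed.

Lemma dhomog_det (R : idomainType) (m c : nat) (M : 'M[{mpoly R[m]}]_c)
    (e : 'I_c -> nat) :
  (forall i j, M i j \is (e i).-homog) -> \det M \is (\sum_i e i).-homog.
Proof.
move=> homM; apply: rpred_sum => s _; rewrite rpredMsign.
exact: dhomog_prod_seq.
Qed.


Section NoFreeLines.
Variables (k : closedFieldType) (n c : nat) (d : c.-tuple nat).
Variables (C : 'I_c -> 'I_n.+1 -> 'I_n.+1 -> k) (i0 : 'I_c) (q r : nat).

Let F (i : 'I_c) : {mpoly k[n.+1]} := powlin (tnth d i) (C i).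

Hypothesis smoothF : smooth_complete_intersection d F.
Hypothesis degE : tnth d i0 = (q.+1 + r.+1).+1.

Variable L : 'M[k]_(2, n.+1).
Hypothesis lineL : line_in F L.

Let x (o : option k) : 'rV[k]_n.+1 := hcoord o *m L.
Let J (o : option k) := jacobian F (x o).
Let der i l := line_der L (tnth d i) (C i) l.

Lemma jacobian_line o i l : J o i l = heval (der i l) o.
Proof. by rewrite mxE /mevalv mderiv_powlin /heval meval_line_der. Qed.

Lemma row_free_jacobian_line o : row_free (J o).
Proof.
have [freeL onL] := lineL; apply/eqP/smoothF.2; last exact/onL/hcoord_neq0.
by rewrite mulmx_free_eq0 // hcoord_neq0.
Qed.

Variables A B : 'I_n.+1 -> {mpoly k[2]}.
Hypothesis homA : forall l, A l \is r.-homog.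
Hypothesis homB : forall l, B l \is q.-homog.
Hypothesis splitAB :
  forall l, der i0 l = 'X_0 ^+ q.+2 * A l + 'X_1 ^+ r.+2 * B l.

Let dot (V : 'I_n.+1 -> {mpoly k[2]}) (o : option k) (w : 'rV[k]_n.+1) : k :=
  \sum_l heval (V l) o * w 0 l.

Lemma dotB V o w w' : dot V o (w - w') = dot V o w - dot V o w'.
Proof. by rewrite -sumrB; apply: eq_bigr => l _; rewrite !mxE mulrBr. Qed.

Lemma dotZ V o z w : dot V o (z *: w) = z * dot V o w.
Proof. by rewrite mulr_sumr; apply: eq_bigr => l _; rewrite !mxE mulrCA. Qed.

Lemma jacobian_dot o (w : 'rV_n.+1) : \sum_l J o i0 l * w 0 l =
  hcoord o 0 0 ^+ q.+2 * dot A o w + hcoord o 0 1 ^+ r.+2 * dot B o w.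
Proof.
rewrite !mulr_sumr -big_split; apply: eq_bigr => l _ /=.
by rewrite jacobian_line splitAB hevalD !hevalXnM mulrDl !mulrA.
Qed.

(** On vectors killed by the gradient of [F i0], [A / t ^ (r + 2)] and
[- B / s ^ (q + 2)] are two expressions of one linear form with values in O(-1),
so it maps global sections to [0].  The local expressions of [T] are only
compared through [A] and [B], to allow [T] to be given modulo the point. *)
Lemma dot_section (T : option k -> 'rV[k]_n.+1) :
  (forall o, \sum_l J o i0 l * T o 0 l = 0) ->
  (forall o, exists m (h : {mpoly k[2]}) (g : 'I_n.+1 -> {mpoly k[2]}),
    [/\ h \is m.-homog, forall l, g l \is m.+1.-homog, heval h o != 0
      & forall o', heval h o' != 0 ->
         let w := (heval h o')^-1 *: \row_l heval (g l) o' in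
         dot A o' (T o') = dot A o' w /\ dot B o' (T o') = dot B o' w]) ->
  forall o, dot A o (T o) = 0 /\ dot B o (T o) = 0.
Proof.
move=> tanT regT.
(* Some coordinate of [hcoord o] is [1], so no denominators appear in [f]. *)
pose f o := if o is Some _ then dot A o (T o) else - dot B o (T o).
have dotg V (g : 'I_n.+1 -> {mpoly k[2]}) o' :
    dot V o' (\row_l heval (g l) o') = heval (\sum_l V l * g l) o'.
  rewrite /heval /mevalv raddf_sum; apply: eq_bigr => l _.
  by rewrite /= mevalM mxE.
have homX (i : 'I_2) e : ('X_i ^+ e : {mpoly k[2]}) \is e.-homog.
  have hX : ('X_i : {mpoly k[2]}) \is 1.-homog by rewrite dhomogX /= mdeg1.
  by have := dhomogMn e hX; rewrite mul1n.
have regf o : regular_at 1 f o.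
  have [m [h [g [homh homg nzh Tg]]]] := regT o.
  have homVg e (V : 'I_n.+1 -> {mpoly k[2]}) : (forall l, V l \is e.-homog) ->
      \sum_l V l * g l \is (m + e).+1.-homog.
    move=> homV; apply: rpred_sum => l _.
    by have := dhomogM (homV l) (homg l); rewrite addnS addnC.
  case: o nzh => [u|] nzh.
    exists (m + r).+1, ('X_1 ^+ r.+2 * h), (\sum_l A l * g l); split.
    - have := dhomogM (homX 1 r.+2) homh.
      by rewrite addn1 -addnS -addnS addnC.
    - exact: homVg.
    - by rewrite hevalXnM mxE /= expr1n mul1r.
    case=> [u'|]; rewrite hevalXnM mxE /= ?expr0n ?mul0r ?eqxx // expr1n mul1r.
    by move=> /Tg[-> _]; rewrite dotZ dotg mulrC.
  exists (m + q).+1, ('X_0 ^+ q.+2 * h), (- \sum_l B l * g l); split.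
  - have := dhomogM (homX 0 q.+2) homh.
    by rewrite addn1 -addnS -addnS addnC.
  - by rewrite rpredN; apply: homVg.
  - by rewrite hevalXnM mxE /= expr1n mul1r.
  have hN G o : heval (- G) o = - heval G o by rewrite /heval /mevalv mevalN.
  case=> [u'|]; rewrite hevalXnM hN mxE /=; last first.
    by rewrite expr1n mul1r => /Tg[_ ->]; rewrite dotZ dotg mulrC mulNr.
  rewrite mulf_eq0 negb_or => /andP[nzu nzh'].
  have := tanT (Some u'); rewrite jacobian_dot !mxE /= expr1n mul1r.
  move/eqP; rewrite addr_eq0; have [_ ->] := Tg _ nzh'.
  rewrite dotZ dotg => /eqP eqAB.
  move: (u' ^+ q.+2) nzu eqAB => z nzz eqAB.
  by rewrite -[LHS](mulKf nzz) eqAB invfM mulrN mulNr mulrA mulrC.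
have f0 := regular_negative_eq0 (ltn0Sn 0) regf.
case=> [u|]; [have := f0 (Some u) | have := f0 None]; rewrite /f => dot0.
  have := tanT (Some u); rewrite jacobian_dot !mxE /= dot0 mulr0 add0r expr1n mul1r.
  by [].
have := tanT None; rewrite jacobian_dot !mxE /= expr1n expr0n mul0r addr0 mul1r.
by split=> //; apply/eqP; rewrite -oppr_eq0 dot0.
Qed.

(** By Euler's identity the point itself, a lift of the zero section, is killed by
the gradient; hence [A] and [B] act on tangent vectors modulo the point. *)
Lemma dot_point o : dot A o (x o) = 0 /\ dot B o (x o) = 0.
Proof.
apply: dot_section => {}o.
  have [_ onL] := lineL; have /(_ i0) := onL _ (hcoord_neq0 o).
  rewrite /mevalv meval_powlin => val0.
  have d_gt0 : (0 < tnth d i0)%N by rewrite degE.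
  have := powlin_euler (C i0) (fun j => (hcoord o *m L) 0 j) d_gt0.
  rewrite val0 mul0rn => euler; rewrite -[RHS]euler; apply: eq_bigr => l _.
  by rewrite mxE /mevalv mderiv_powlin.
exists 0, 1, (line_coord L); split=> [|||o' _ w].
- exact: dhomog1.
- exact: line_coord_homog.
- by rewrite /heval /mevalv meval1 oner_eq0.
have -> : w = x o'; last by [].
rewrite /w /heval {1}/mevalv meval1 invr1 scale1r; apply/rowP => l.
by rewrite mxE meval_line_coord.
Qed.

Lemma dot_eq_tangent V o w w' : dot V o (x o) = 0 ->
  eq_tangent (x o) w w' -> dot V o w = dot V o w'.
Proof.
move=> Vx /sub_rVP[z ww']; apply/eqP; rewrite -subr_eq0 -dotB ww' dotZ Vx.
by rewrite mulr0.
Qed.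

Hypothesis freeL : free_line F L.

Lemma dot_tangent o w : tangent_to F (x o) w -> dot A o w = 0.
Proof.
move=> tanw; have [s [tan_s _ reg_s] sw] := freeL (hcoord_neq0 o) tanw.
have [Ax Bx] := (fun o' => (dot_point o').1, fun o' => (dot_point o').2).
rewrite -(dot_eq_tangent (Ax o) sw).
suff /(_ o)[] : forall o, dot A o (s (hcoord o)) = 0 /\ dot B o (s (hcoord o)) = 0 by [].
apply: (@dot_section (fun o => s (hcoord o))) => o1.
  have := congr1 (fun M : 'cV_c => M i0 0) (tan_s _ (hcoord_neq0 o1)).
  rewrite !mxE => {2}<-; apply: eq_bigr => l _.
  by rewrite [s _ 0 l in LHS](_ : _ = (s (hcoord o1))^T l 0) // mxE.
have [m [h [g [homh homg nzh sg]]]] := reg_s _ (hcoord_neq0 o1).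
exists m, h, g; split=> // o' nzh' w'.
have sgo := sg _ nzh' (hcoord_neq0 o').
by split; apply: dot_eq_tangent sgo.
Qed.

Let Arow o : 'rV[k]_n.+1 := \row_l heval (A l) o.

(** A linear form killing the common kernel of the gradients is a combination of
them. *)
Lemma Arow_sub_jacobian o : (Arow o <= J o)%MS.
Proof.
rewrite submxE; apply/eqP/rowP => j.
have tanj : tangent_to F (x o) (col j (cokermx (J o)))^T.
  by rewrite /tangent_to trmxK -/(J o) colE mulmxA mulmx_coker mul0mx.
rewrite [RHS]mxE -[RHS](dot_tangent tanj) mxE.
by apply: eq_bigr => l _; rewrite !mxE.
Qed.

(** The coordinates of [A] with respect to the gradients of the equations. *)
Let lam o : 'rV[k]_c := Arow o *m pinvmx (J o).

Lemma lam_jacobian o : lam o *m J o = Arow o.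
Proof. exact/mulmxKpV/Arow_sub_jacobian. Qed.

Lemma lam_infinity : lam None 0 i0 = 1.
Proof.
have -> : lam None = delta_mx 0 i0; last by rewrite mxE !eqxx.
apply: (row_free_inj (row_free_jacobian_line None)).
rewrite lam_jacobian -rowE; apply/rowP => l; rewrite [LHS]mxE [RHS]mxE jacobian_line.
rewrite splitAB hevalD !hevalXnM !mxE /=.
by rewrite expr1n expr0n mul0r addr0 mul1r.
Qed.

(** Cramer's rule: near [o] the coordinate is the quotient of a minor of the
Jacobian matrix with row [i0] replaced by [A], of degree [r] instead of
[q + r + 2], by that minor. *)
Lemma lam_regular o : regular_at q.+2 (fun o => lam o 0 i0) o.
Proof.
have fullJ : row_full (J o)^T.
  by rewrite /row_full mxrank_tr; apply: row_free_jacobian_line.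
pose f := fullrankfun fullJ.
pose M : 'M[{mpoly k[2]}]_c := \matrix_(i, j) der i (f j).
pose N : 'M[{mpoly k[2]}]_c := \matrix_(i, j) if i == i0 then A (f j) else M i j.
have evdet (P : 'M[{mpoly k[2]}]_c) o' :
    heval (\det P) o' = \det (map_mx (fun G => heval G o') P).
  by rewrite /heval /mevalv -det_map_mx.
exists (\sum_i if i == i0 then r else (tnth d i).-1)%N, (\det M), (\det N); split.
- have -> : (\sum_i (if i == i0 then r else (tnth d i).-1) + q.+2 =
      \sum_i (tnth d i).-1)%N.
    rewrite (bigD1 i0) //= eqxx [RHS](bigD1 i0) //= degE /= addnAC; congr (_ + _)%N.
      by rewrite addnC addSnnS.
    by apply: eq_bigr => i /negPf->.
  by apply: dhomog_det => i j; rewrite mxE; apply: line_der_homog.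
- by apply: dhomog_det => i j; rewrite !mxE; case: eqP => // _; apply: line_der_homog.
- have := fullrowsub_unit fullJ; rewrite unitmxE unitfE -det_tr evdet.
  congr (\det _ != 0); apply/matrixP => i j.
  by rewrite !mxE -/f -[RHS]jacobian_line mxE.
move=> o'; rewrite !evdet; set Mo := map_mx _ M; set No := map_mx _ N => nzM.
have lamM : lam o' *m Mo = \row_j heval (A (f j)) o'.
  apply/rowP => j; have /rowP/(_ (f j)) lamj := lam_jacobian o'.
  rewrite [RHS]mxE in lamj; rewrite [RHS]mxE -lamj.
  by rewrite !mxE; apply: eq_bigr => i _; rewrite !mxE -jacobian_line mxE.
apply: (mulIf nzM); rewrite divfK //.
have := congr1 (fun P : 'rV_c => (P *m \adj Mo) 0 i0) lamM.
rewrite -mulmxA mul_mx_adj mul_mx_scalar mxE mulrC => ->.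
rewrite (expand_det_row No i0) mxE; apply: eq_bigr => j _; rewrite !mxE eqxx.
congr (_ * (_ * \det _)); apply/matrixP => i l; rewrite !mxE.
by rewrite eq_sym (negPf (neq_lift _ _)).
Qed.

Lemma free_line_absurd : False.
Proof.
have := regular_negative_eq0 (ltn0Sn _) lam_regular None.
by rewrite lam_infinity => /eqP; rewrite oner_eq0.
Qed.

End NoFreeLines.

(** * Nonspecial tuples *)

Lemma nonspecial_tuple_entry (p c : nat) (d : c.-tuple nat) :
  p_nonspecial_tuple p d ->
  exists2 i : 'I_c, (p <= tnth d i)%N &
    ~ (((p %| tnth d i)%N -> p_special p (tnth d i)) /\
       (coprime p (tnth d i) -> p_special p (tnth d i).+1)).
Proof.
pose spec m : bool := (1 <= m`_p^' < p)%N.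
pose ok m := ((p %| m)%N ==> spec m) && (coprime p m ==> spec m.+1).
move=> hns; have [all_ok | /forallPn[i]] :=
  boolP [forall i : 'I_c, (p <= tnth d i)%N ==> ok (tnth d i)].
  case: hns => i le_pd; have /implyP/(_ le_pd)/andP[] := forallP all_ok i.
  by move=> /implyP ? /implyP ?.
rewrite negb_imply => /andP[le_pd not_ok]; exists i => // -[spec1 spec2].
by case/negP: not_ok; apply/andP; split; apply/implyP.
Qed.

Theorem proposition1p9 (k : closedFieldType) (p : nat) (hp : p \in [pchar k])
    (c : nat) (d : c.-tuple nat) (hd : forall i : 'I_c, (0 < tnth d i)%N)
    (hns : p_nonspecial_tuple p d) (hmax : (p <= \max_(i < c) tnth d i)%N)
    (n : nat) (hfano : 2 <= fano_index n d) :
  exists F : 'I_c -> {mpoly k[n.+1]},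
    smooth_complete_intersection d F /\
    (forall L : 'M[k]_(2, n.+1), line_in F L -> ~ free_line F L).
Proof.
have [i0 le_pd nspec] := nonspecial_tuple_entry hns.
have [q [r [dE pC]]] := nonspecial_binomial (pcharf_prime hp) le_pd nspec.
have bin0 : 'C(q.+1 + r.+1, r.+1)%:R = 0 :> k.
  by apply/eqP; rewrite -(dvdn_pcharf hp).
have [C smoothF] := @exists_smooth_powlin k n c d hd.
exists (fun i => powlin (tnth d i) (C i)); split=> // L lineL freeL.
have split_der l : splits q r (line_der L (tnth d i0) (C i0) l).
  by apply: splits_line_der; rewrite // dE.
have [A /fin_all_exists[B AB]] := fin_all_exists split_der.
by apply: (free_line_absurd smoothF dE lineL (A := A) (B := B)) => // l; case: (AB l).
Qed.
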